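(* Let $U,b$ be strictly positive rationals, $T\ge1$ an integer, $\mu,x_0\in[0,U]_{\mathcal Q}$. If $x_0\in[0,\chi^T_{\mathbf{MAR}}(\mu,U,b)]$, then one can construct a random vector $\hat{\mathbf D}^*=(\hat D^*_1,\dots,\hat D^*_T)$ distributed as $\hat Q^*$ on a common probability space with the Markov chain $M^T$ such that $\{(\hat x^*_t(\hat D^*_{[t-1]}),\hat D^*_t),\,t\in[1,T]\}$ equals $\{(\mathcal X^T_t,\mathcal D^T_t),\,t\in[1,T]\}$ with probability 1. Furthermore, $\{D^T_t,\,t\in[1,\Lambda^T]\}$ and $\{X^T_t,\,t\in[1,\Lambda^T]\}$ are both monotone increasing (i.e. non-decreasing), with $X^T_t\le D^T_t$ for all $t\in[1,\Lambda^T]$ and $D^T_{\Lambda^T}=U$.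
   Context: $[0,U]_{\mathcal Q}=[0,U]\cap\mathbb Q$; intervals of time/index variables are integer intervals; for a vector $\mathbf d$, $\mathbf d_{[s]}=(d_1,\dots,d_s)$. Empty products equal 1. Explicit quantities, for each integer $T\ge1$: for $j\in[-1,T-1]$, $A^T_j=U\prod_{k=j+1}^{T-1}\frac{k}{b+k}$, and $A^T_T=\frac{b+T}{T}U$; for $j\in[-1,T]$, $B^T_j=\frac{j}{b+T}A^T_j$. $\Gamma^T_\mu=0$ if $\mu=0$, and $\Gamma^T_\mu=j+1$ if $\mu\in(A^{T+1}_j,A^{T+1}_{j+1}]$, $j\in[-1,T-1]$. $\chi^T_{\mathbf{MAR}}(\mu,U,b)=B^T_{\Gamma^T_\mu}$. For $x,\mu\in[0,U]$, $\mathfrak q^T_{x,\mu}$ is the probability measure given by: (i) if $\mu\in(A^T_j,A^T_{j+1}]$ and $x\in[0,B^T_{j+1})$: $\mathfrak q^T_{x,\mu}(A^T_j)=\frac{A^T_{j+1}-\mu}{A^T_{j+1}-A^T_j}$, $\mathfrak q^T_{x,\mu}(A^T_{j+1})=\frac{\mu-A^T_j}{A^T_{j+1}-A^T_j}$; (ii) if $\mu\in(A^T_j,A^T_{j+1}]$ and $x\in[B^T_k,B^T_{k+1})$ with $k\ge j+1$: $\mathfrak q^T_{x,\mu}(0)=1-\frac{\mu}{A^T_k}$, $\mathfrak q^T_{x,\mu}(A^T_k)=\frac{\mu}{A^T_k}$; (iii) if $\mu=0$ or $x=U$: $\mathfrak q^T_{x,\mu}(0)=1-\frac{\mu}{U}$,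 $\mathfrak q^T_{x,\mu}(U)=\frac{\mu}{U}$. Policy $\hat\pi^*=(\hat x^*_1,\dots,\hat x^*_T)$: $\hat x^*_1=\max(x_0,\chi^T_{\mathbf{MAR}}(\mu,U,b))$ and, for $t\in[1,T-1]$, $\hat x^*_{t+1}(\mathbf d_{[t]})=\max(\hat x^*_t(\mathbf d_{[t-1]})-d_t,\chi^{T-t}_{\mathbf{MAR}}(d_t,U,b))$. Measure $\hat Q^*$ on $[0,U]_{\mathcal Q}^T$: the first coordinate has law $\mathfrak q^T_{\hat x^*_1,\mu}$, and given that the first $t$ coordinates equal $\mathbf d=(d_1,\dots,d_t)$ (of positive probability), coordinate $t+1$ has conditional law $\mathfrak q^{T-t}_{\hat x^*_{t+1}(\mathbf d),d_t}$. Markov chain. $\Lambda^T=\max(T-\Gamma^T_\mu,1)$; for $t\in[1,\Lambda^T]$: $D^T_t=A^{T+1-t}_{\min(\Gamma^T_\mu,T-1)}$, $X^T_t=B^{T+1-t}_{\Gamma^T_\mu}$. $M^T(t)=(\mathcal X^T_t,\mathcal D^T_t)$, $t\ge1$, is the Markov chain with: $(\mathcal X^T_1,\mathcal D^T_1)=(X^T_1,D^T_1)$ with probability $\mu/D^T_1$ and $(X^T_1,0)$ with probability $1-\mu/D^T_1$; for $t\in[2,\Lambda^T]$: if $\mathcal D^T_{t-1}=0$ then $(\mathcal X^T_t,\mathcal D^T_t)=(\mathcal X^T_{t-1},0)$ with probability 1; if $\mathcal D^T_{t-1}\ne0$ then $(\mathcal X^T_t,\mathcal D^T_t)=(X^T_t,D^T_t)$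 with probability $D^T_{t-1}/D^T_t$ and $(X^T_t,0)$ with probability $1-D^T_{t-1}/D^T_t$; for $t\ge\Lambda^T+1$: $(\mathcal X^T_t,\mathcal D^T_t)=(\mathcal X^T_{\Lambda^T},0)$ if $\mathcal D^T_{\Lambda^T}=0$, and $=(U,U)$ if $\mathcal D^T_{\Lambda^T}=U$. *)

(* Defs.v *)
From mathcomp Require Import all_boot all_order all_algebra.
From mathcomp Require Import all_classical all_reals all_analysis.

Set Implicit Arguments.
Unset Strict Implicit.
Unset Printing Implicit Defensive.

Import Order.TTheory GRing.Theory Num.Theory.

Local Open Scope classical_set_scope.
Local Open Scope ring_scope.

(* U, b, the mean mu, the initial inventory x0 and all quantities built from
   them are rational; only probabilities live in the realType R. *)

(* [coefA U b T j] is A^T_j, for T >= 1 and an integer index -1 <= j <= T;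
   the absolute value only serves to turn j + 1 >= 0 into a nat. *)
Definition coefA (U b : rat) (T : nat) (j : int) : rat :=
  if j == T%:Z then (b + T%:R) / T%:R * U
  else U * \prod_(`|(j + 1)%R|%N <= k < T) (k%:R / (b + k%:R)).

Definition coefB (U b : rat) (T : nat) (j : int) : rat :=
  j%:~R / (b + T%:R) * coefA U b T j.

(* Below, an interval (A^T_j, A^T_{j+1}] with j >= -1 is designated by its
   upper index i = j + 1 >= 0.  These intervals are pairwise disjoint, so [pick]
   returns the unique one containing mu (it exists when 0 < mu <= U). *)
Definition Gam (U b : rat) (T : nat) (mu : rat) : nat :=
  if mu == 0 then 0%N else
  if [pick i : 'I_T.+1 | (coefA U b T.+1 (i%:Z - 1) < mu)
                         && (mu <= coefA U b T.+1 i%:Z)] is Some i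
  then val i else 0%N.

Definition chiMAR (U b : rat) (T : nat) (mu : rat) : rat :=
  coefB U b T (Gam U b T mu)%:Z.

(* Probability mass function of the measure giving mass p to a, q to c. *)
Definition two_point (a p c q : rat) (y : rat) : rat :=
  (y == a)%:R * p + (y == c)%:R * q.

(* Mass function of q^T_{x,mu}, for x, mu in [0, U]; the two zero branches are
   unreachable for such x, mu. *)
Definition qlaw (U b : rat) (T : nat) (x mu : rat) : rat -> rat :=
  if (mu == 0) || (x == U) then two_point 0 (1 - mu / U) U (mu / U) else
  if [pick i : 'I_T | (coefA U b T (i%:Z - 1) < mu)
                      && (mu <= coefA U b T i%:Z)] is Some i then
    let lo := coefA U b T (i%:Z - 1) in
    let hi := coefA U b T i%:Z in
    if (0 <= x) && (x < coefB U b T i%:Z) then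
      two_point lo ((hi - mu) / (hi - lo)) hi ((mu - lo) / (hi - lo))
    else
    if [pick k : 'I_T | [&& (i <= k)%N, coefB U b T k%:Z <= x
                          & x < coefB U b T (k%:Z + 1)]] is Some k then
      let Ak := coefA U b T k%:Z in
      two_point 0 (1 - mu / Ak) Ak (mu / Ak)
    else fun=> 0
  else fun=> 0.

(* [xhat U b T mu x0 t d] is the order-up-to level of period t >= 1 after the
   demands d_1, ..., d_{t-1}, with d_s stored at position s - 1 of the list d;
   the value at t = 0 is a dummy. *)
Fixpoint xhat (U b : rat) (T : nat) (mu x0 : rat) (t : nat) (d : seq rat) : rat :=
  if t is s.+1 then
    if s == 0%N then Num.max x0 (chiMAR U b T mu)
    else Num.max (xhat U b T mu x0 s d - d`_s.-1) (chiMAR U b (T - s) d`_s.-1)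
  else x0.

Definition Lam (U b : rat) (T : nat) (mu : rat) : nat :=
  maxn (T - Gam U b T mu) 1.

Definition Dlev (U b : rat) (T : nat) (mu : rat) (t : nat) : rat :=
  coefA U b (T + 1 - t) (minn (Gam U b T mu) (T - 1))%:Z.

Definition Xlev (U b : rat) (T : nat) (mu : rat) (t : nat) : rat :=
  coefB U b (T + 1 - t) (Gam U b T mu)%:Z.

(* Random variable with values in the discrete measurable space S. *)
Definition discrete_rv (d : measure_display) (Om : measurableType d) (S : Type)
  (X : Om -> S) : Prop := forall E : set S, measurable (X @^-1` E).

(* Conditional probability of E given F; only used when P F > 0. *)
Definition cprob (R : realType) (d : measure_display) (Om : measurableType d)
  (P : probability Om R) (E F : set Om) : R := fine (P (E `&` F)) / fine (P F).

(* The random vector D, with values in ([0, U] n Q)^T, has law Qhat*. *)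
Definition distributed_Qhat (R : realType) (d : measure_display)
  (Om : measurableType d) (P : probability Om R) (U b : rat) (T : nat)
  (mu x0 : rat) (D : Om -> T.-tuple rat) : Prop :=
  [/\ discrete_rv D,
      (forall (w : Om) (i : 'I_T), 0 <= tnth (D w) i <= U),
      (forall y : rat, P [set w | (D w)`_0 = y]
        = (ratr (qlaw U b T (xhat U b T mu x0 1 [::]) mu y))%:E)
    & (forall (t : nat) (s : seq rat) (y : rat), (1 <= t < T)%N ->
        (0 < P [set w | take t (D w) = s])%E ->
        cprob P [set w | (D w)`_t = y] [set w | take t (D w) = s]
        = ratr (qlaw U b (T - t) (xhat U b T mu x0 t.+1 s) s`_t.-1 y))].

(* Processes are indexed by t >= 1; their value at time 0 is irrelevant. *)
Definition markov_property (R : realType) (d : measure_display)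
  (Om : measurableType d) (P : probability Om R) (S : Type)
  (M : nat -> Om -> S) : Prop :=
  forall (t : nat) (s : nat -> S) (y : S), (1 <= t)%N ->
    let past := [set w | forall r : nat, (1 <= r <= t)%N -> M r w = s r] in
    (0 < P past)%E ->
    cprob P [set w | M t.+1 w = y] past
    = cprob P [set w | M t.+1 w = y] [set w | M t w = s t].

(* M is a realization of the chain M^T; the state at time t is the pair
   (calX^T_t, calD^T_t). *)
Definition is_chain_MT (R : realType) (d : measure_display)
  (Om : measurableType d) (P : probability Om R) (U b : rat) (T : nat)
  (mu : rat) (M : nat -> Om -> rat * rat) : Prop :=
  let Lm := Lam U b T mu in
  let X := Xlev U b T mu in
  let D := Dlev U b T mu in
  [/\ (forall t : nat, (1 <= t)%N -> discrete_rv (M t)),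
      markov_property P M,
      P [set w | M 1%N w = (X 1%N, D 1%N)] = (ratr (mu / D 1%N))%:E
      /\ P [set w | M 1%N w = (X 1%N, 0)] = (ratr (1 - mu / D 1%N))%:E,
      (forall (t : nat) (x y : rat), (2 <= t <= Lm)%N ->
        let past := [set w | M t.-1 w = (x, y)] in
        (0 < P past)%E ->
        (y = 0 -> cprob P [set w | M t w = (x, 0)] past = 1) /\
        (y <> 0 ->
          cprob P [set w | M t w = (X t, D t)] past
            = ratr (D t.-1 / D t) /\
          cprob P [set w | M t w = (X t, 0)] past
            = ratr (1 - D t.-1 / D t)))
    & (forall (t : nat) (w : Om), (Lm + 1 <= t)%N ->
        ((M Lm w).2 = 0 -> M t w = ((M Lm w).1, 0)) /\
        ((M Lm w).2 = U -> M t w = (U, U)))].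

(* Main.v *)
Require Import Defs.
From mathcomp Require Import all_boot all_order all_algebra.
From mathcomp Require Import all_classical all_reals all_analysis.
From mathcomp Require Import ring zify.

Import Order.TTheory GRing.Theory Num.Theory.
Local Open Scope classical_set_scope.
Local Open Scope ring_scope.

(** The policy is tailored to the worst-case martingale: if the last demand is
    [m] and [n] periods remain, ordering up to [chiMAR U b n m = B^n_G] with
    [G = Gam U b n m] puts the inventory exactly on the left end of the
    interval of inventories that makes nature answer with a law on two points,
    zero and [A^n_(min(G, n - 1))] ([qlaw_chiMAR]).  So, along the support of
    the worst-case measure, the demand either dies (becomes zero) or jumps to a
    deterministic level.  A dead demand stays dead, because the law with mean
    zero is concentrated at zero, and the inventory then stays put, because
    the order-up-to level attached to demand zero is zero.

    While the demand is alive its level at time [t] is [A^(T+1-t)_G], which is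
    the right end of the interval that defines [Gam] at horizon [T - t].
    Hence [Gam] does not change from one period to the next, except that it is
    truncated at the remaining horizon, where the level has reached [U]
    ([levels_succ]).  This identifies the levels produced by the policy with
    the deterministic sequences that define the Markov chain.

    All randomness is therefore contained in one integer, the number of periods
    that the demand survives.  Surviving period [t] has probability [mu / D_t]
    (the transition probabilities [D_(t-1) / D_t] telescope), so a law on [nat]
    with this survival function ([survival_law]) carries both the chain and the
    demand vector as functions of the same outcome: [traj] is the common path,
    [traj_markov] and [traj_chain_MT] show that it is the chain, [demand_Qhat]
    that its demands follow the worst-case measure, and [xhat_traj] that the
    policy fed with these demands reproduces the inventory component, at every
    outcome and not only almost surely. *)

(* The polynomial library has a lemma of the same name. *)
Local Notation coefB := Defs.coefB.

(** * Elementary conditional probabilities *)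

Section Cprob.
Context (R : realType) (d : measure_display) (Om : measurableType d).
Context (P : probability Om R).
Implicit Types E F A : set Om.

Lemma cprob_ext E E' F : (forall w, F w -> E w <-> E' w) ->
  cprob P E F = cprob P E' F.
Proof.
move=> EE'; rewrite /cprob; congr (fine (P _) / _).
by apply/seteqP; split=> w [? Fw]; split=> //; apply/(EE' w Fw).
Qed.

Lemma prob_gt0_nonempty F : (0 < P F)%E -> F !=set0.
Proof.
by move=> F0; apply/set0P/eqP => p0; move: F0; rewrite p0 measure0 ltxx.
Qed.

Lemma fine_prob_neq0 F : (0 < P F)%E -> measurable F -> fine (P F) != 0.
Proof.
move=> F0 mF; rewrite gt_eqF// fine_gt0// F0 /=.
by rewrite (le_lt_trans (probability_le1 _ _))// ltry.
Qed.

Lemma cprobC E F : measurable E -> measurable F -> (0 < P F)%E ->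
  cprob P (~` E) F = 1 - cprob P E F.
Proof.
move=> mE mF F0; have Fn0 := fine_prob_neq0 _ F0 mF.
rewrite /cprob -(divff Fn0) -mulrBl; congr (_ / _).
have mEF : measurable (E `&` F) by exact: measurableI.
have mCEF : measurable (~` E `&` F).
  by apply: measurableI => //; exact: measurableC.
apply: (addrI (fine (P (E `&` F)))); rewrite [RHS]addrC subrK.
rewrite -fineD ?fin_num_measure// -measureU//.
  by rewrite -setIUl setUv setTI.
by rewrite setIACA setICr set0I.
Qed.

Lemma cprobT F : measurable F -> (0 < P F)%E -> cprob P setT F = 1.
Proof. by move=> mF F0; rewrite /cprob setTI divff// fine_prob_neq0. Qed.

Lemma cprob0 F : cprob P set0 F = 0.
Proof. by rewrite /cprob set0I measure0 mul0r. Qed.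

Lemma cprob_setT E : cprob P E setT = fine (P E).
Proof. by rewrite /cprob setIT probability_setT divr1. Qed.

Lemma cprob_const (S : eqType) F (f : Om -> S) (z y : S) :
  measurable F -> (0 < P F)%E -> (forall w, F w -> f w = z) ->
  cprob P [set w | f w = y] F = (y == z)%:R.
Proof.
move=> mF F0 fz; have [->|/eqP yz] := eqVneq y z.
  by rewrite (cprob_ext _ setT) ?cprobT// => w /fz fwz; split.
by rewrite (cprob_ext _ set0) ?cprob0// => w /fz /= ->; split => // /esym.
Qed.

(** Every law met below is of this kind: a variable that equals [c] on [A] and
    vanishes elsewhere, so that only the probability of [A] has to be known. *)
Lemma cprob_two_point F A (f : Om -> rat) (c p y : rat) :
  measurable F -> measurable A -> (0 < P F)%E -> c != 0 ->
  (forall w, F w -> A w -> f w = c) -> (forall w, F w -> ~ A w -> f w = 0) ->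
  cprob P A F = ratr p ->
  cprob P [set w | f w = y] F = ratr (two_point 0 (1 - p) c p y).
Proof.
move=> mF mA F0 c0 fc f0 pA; rewrite /two_point.
(* When y = 0 the atom at c must be discarded, which is where c != 0 matters. *)
have [->|y0] := eqVneq y 0.
  rewrite eq_sym (negbTE c0) mul0r addr0 mul1r (cprob_ext _ (~` A)).
    by rewrite cprobC// pA rmorphB rmorph1.
  move=> w Fw; split => [/= fw Aw|/f0]; last exact.
  by move: c0; rewrite -(fc w Fw Aw) fw eqxx.
rewrite mul0r add0r; have [yc|yc] := eqVneq y c.
  rewrite mul1r -pA; apply: cprob_ext => w Fw; split=> [/= fw|/(fc w Fw) fwc];
    last by rewrite /= fwc.
  by apply: contrapT => /(f0 w Fw) fw0; move: y0; rewrite -fw fw0 eqxx.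
rewrite mul0r rmorph0 -(cprob0 F); apply: cprob_ext => w Fw; split=> //= fw.
have [/(fc w Fw) fwc|/(f0 w Fw) fw0] := pselect (A w).
  by move: yc; rewrite -fw fwc eqxx.
by move: y0; rewrite -fw fw0 eqxx.
Qed.

End Cprob.

Arguments prob_gt0_nonempty {R d Om P F}.
Arguments cprob_ext {R d Om P E} E' {F}.
Arguments cprob_const {R d Om P S F f} z {y}.

Lemma mnormalize1 (R : realType) (d : measure_display) (Om : measurableType d)
  (m : {measure set Om -> \bar R}) (P : probability Om R) A :
  m setT = 1%E -> mnormalize m P A = m A.
Proof. by move=> m1; rewrite /mnormalize m1 onee_eq0/= invr1 mule1. Qed.

(** * A law on the natural numbers with a given survival function *)

Section Survival.
Context (R : realType) (S : nat -> R) (N : nat).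
Context (S0 : S 0%N = 1).
Context (S_noninc : forall n, (n < N)%N -> S n.+1 <= S n).
Context (SN : 0 <= S N).

(* Truncating at N puts the whole mass that survives N on the point N. *)
Let S' n := if (n <= N)%N then S n else 0.

Let jump_ge0 n : 0 <= S' n - S' n.+1.
Proof.
rewrite /S' subr_ge0; case: (ltngtP n N) => [nN|Nn|->]; rewrite ?leqnn ?ltnn//.
exact: S_noninc.
Qed.

Let jump n : {nonneg R} := NngNum (jump_ge0 n).

Let mix : set nat -> \bar R :=
  msum (fun n => mscale (jump n) (@dirac _ nat n R)) N.+1.

Let mix_tail t : (t <= N)%N -> mix [set n | (t <= n)%N] = (S t)%:E.
Proof.
move=> tN; rewrite /mix /msum.
pose A : set nat := [set n | (t <= n)%N].
transitivity (\sum_(k < N.+1) ((S' k - S' k.+1) * (val k \in A)%:R)%:E)%E.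
  by apply: eq_bigr => k _; rewrite EFinM; congr (_ * _)%E; exact: diracE.
rewrite sumEFin; congr _%:E.
rewrite -(big_mkord xpredT (fun k => (S' k - S' k.+1) * (k \in A)%:R)).
rewrite (big_cat_nat _ (leqW tN))//= big_nat big1 ?add0r; last first.
  by move=> k /andP[_ kt]; rewrite memNset ?mulr0// /A /= leqNgt kt.
rewrite big_nat (eq_bigr (fun k => - S' k.+1 - - S' k)); last first.
  by move=> k /andP[tk _]; rewrite mem_set// mulr1 opprK addrC.
by rewrite -big_nat telescope_sumr ?leqW// /S' ltnn tN opprK oppr0 add0r.
Qed.

(** The mixture of Dirac masses whose weights are the jumps of [S]; its total
    mass is already 1, normalizing only makes it a probability by type. *)
Lemma survival_law : exists P : probability nat R,
  forall t, (t <= N)%N -> P [set n | (t <= n)%N] = (S t)%:E.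
Proof.
exists (mnormalize mix (@dirac _ nat 0%N R)) => t tN.
have mixT : mix setT = 1%E.
  by rewrite -S0 -(mix_tail 0)//; congr mix; apply/seteqP.
transitivity (mnormalize mix (@dirac _ nat 0%N R) [set n | (t <= n)%N]) => //.
transitivity (mix [set n | (t <= n)%N]); last exact: mix_tail.
by rewrite mnormalize1.
Qed.

End Survival.

Section Model.
Context (U b : rat) (hU : 0 < U) (hb : 0 < b).

(** * The breakpoints A^T_j and the inventory levels B^T_j *)

(** [A^T_(i-1)]: shifting the index by one makes it a natural number, and the
    interval designated by its upper index [i] is then [(knot i, knot i.+1]]. *)
Definition knot (T i : nat) : rat := coefA U b T (i%:Z - 1).

Lemma coefA_knot T i : coefA U b T i%:Z = knot T i.+1.
Proof. by rewrite /knot intS addrC addKr. Qed.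

Lemma knotE T i : (i <= T)%N ->
  knot T i = U * \prod_(i <= k < T) (k%:R / (b + k%:R)).
Proof.
move=> iT; rewrite /knot /coefA subrK absz_nat subr_eq -PoszD eqz_nat addn1.
by case: eqP iT => // ->; rewrite ltnn.
Qed.

Lemma knot_full T : knot T T = U.
Proof. by rewrite knotE// big_geq// mulr1. Qed.

Lemma knot_last T : knot T T.+1 = (b + T%:R) / T%:R * U.
Proof. by rewrite -coefA_knot /coefA eqxx. Qed.

Lemma den_gt0 k : 0 < b + k%:R. Proof. by rewrite ltr_wpDr. Qed.

(** The exceptional value [A^T_T] is exactly the one that extends the product
    formula by one more step, so that the recursion holds up to the end. *)
Lemma knot_succ T i : (0 < T)%N -> (i <= T)%N ->
  knot T i = i%:R / (b + i%:R) * knot T i.+1.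
Proof.
move=> T0; rewrite leq_eqVlt => /predU1P[->|iT].
  have T0' : T%:R != 0 :> rat by rewrite pnatr_eq0 -lt0n.
  have bT := lt0r_neq0 (den_gt0 T).
  by rewrite knot_full knot_last; field; rewrite T0' bT.
by rewrite !knotE ?(ltnW iT)// big_ltn// mulrCA.
Qed.

(** Lengthening the horizon rescales all the breakpoints by the same factor,
    again including the exceptional one. *)
Lemma knot_horizon T i : (0 < T)%N -> (i <= T.+1)%N ->
  knot T.+1 i = T%:R / (b + T%:R) * knot T i.
Proof.
move=> T0; rewrite leq_eqVlt => /predU1P[->|]; last rewrite ltnS => iT.
  have T0' : T%:R != 0 :> rat by rewrite pnatr_eq0 -lt0n.
  have bT := lt0r_neq0 (den_gt0 T).
  by rewrite knot_full knot_last; field; rewrite T0' bT.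
by rewrite !knotE// ?leqW// big_nat_recr//= [RHS]mulrC !mulrA; ring.
Qed.

Lemma knot0 T : (0 < T)%N -> knot T 0 = 0.
Proof. by move=> T0; rewrite knot_succ// mul0r mul0r. Qed.

Lemma knot_gt0 T i : (0 < T)%N -> (0 < i <= T.+1)%N -> 0 < knot T i.
Proof.
move=> T0 /andP[i0]; rewrite leq_eqVlt => /predU1P[->|];
  last rewrite ltnS => iT.
  by rewrite knot_last mulr_gt0// divr_gt0// ?den_gt0// ltr0n.
rewrite knotE// mulr_gt0// big_nat_cond prodr_gt0// => k /andP[/andP[ik _] _].
by rewrite divr_gt0// ?den_gt0// ltr0n (leq_trans i0).
Qed.

Lemma knot_ge0 T i : (0 < T)%N -> (i <= T.+1)%N -> 0 <= knot T i.
Proof.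
by move=> T0; case: i => [|i] iT; [rewrite knot0|rewrite ltW// knot_gt0].
Qed.

Lemma ratio_lt1 k : k%:R / (b + k%:R) < 1 :> rat.
Proof. by rewrite ltr_pdivrMr ?den_gt0// mul1r ltrDr. Qed.

Lemma knot_lt T i j : (0 < T)%N -> (i < j <= T.+1)%N -> knot T i < knot T j.
Proof.
move=> T0; elim: j => // j IH /andP[ij jT].
have step : knot T j < knot T j.+1.
  by rewrite knot_succ// gtr_pMl ?ratio_lt1// knot_gt0.
move: ij; rewrite ltnS leq_eqVlt => /predU1P[->//|ij].
by apply: lt_trans step; apply: IH; rewrite ij ltnW.
Qed.

Lemma knot_le T i j : (0 < T)%N -> (i <= j <= T.+1)%N -> knot T i <= knot T j.
Proof.
move=> T0 /andP[]; rewrite leq_eqVlt => /predU1P[->//|ij jT].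
by rewrite ltW// knot_lt// ij.
Qed.

Lemma knot_horizon_le T i : (0 < T)%N -> (i <= T.+1)%N ->
  knot T.+1 i <= knot T i.
Proof.
by move=> T0 iT; rewrite knot_horizon// ler_piMl ?knot_ge0// ltW ?ratio_lt1.
Qed.

Lemma knot_interval_le T i j m : (0 < T)%N -> (i <= T)%N ->
  knot T i < m -> m <= knot T j.+1 -> (i <= j)%N.
Proof.
move=> T0 iT im mj; rewrite leqNgt; apply/negP => ji.
have ji' : knot T j.+1 <= knot T i by rewrite knot_le// ji leqW.
by move: (lt_le_trans im (le_trans mj ji')); rewrite ltxx.
Qed.

(** Evaluates the choices made by [Gam] (over [T.+1] intervals at horizon
    [T.+1]) and by [qlaw] (over [T] intervals at horizon [T]). *)
Lemma pick_knot n T i m : (0 < T)%N -> (n <= T.+1)%N -> (i < n)%N ->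
  knot T i < m <= knot T i.+1 ->
  [pick i : 'I_n | (coefA U b T (i%:Z - 1) < m) && (m <= coefA U b T i%:Z)]
    = insub i.
Proof.
move=> T0 nT inn /andP[im mi]; rewrite insubT.
case: pickP => [j|/(_ (Ordinal inn))].
  rewrite coefA_knot => /andP[jm mj]; congr Some.
  apply: val_inj; apply/eqP => /=.
  have jT : (j <= T)%N by rewrite -ltnS (leq_trans _ nT).
  have iT : (i <= T)%N by rewrite -ltnS (leq_trans _ nT).
  by rewrite eqn_leq (knot_interval_le T j i m)// (knot_interval_le T i j m).
by rewrite coefA_knot /= -/(knot T i) im mi.
Qed.

Lemma knot_locate n T m : (0 < T)%N -> 0 < m -> m <= knot T n ->
  exists2 i, (i < n)%N & knot T i < m <= knot T i.+1.
Proof.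
move=> T0 m0; elim: n => [|n IH] mn.
  by move: m0; rewrite ltNge -(knot0 T)// mn.
have [nm|] := ltP (knot T n) m; first by exists n => //; rewrite nm.
by move=> /IH[i ilt mi]; exists i => //; rewrite ltnW.
Qed.

(** * The order-up-to index and the answer of nature *)

Lemma Gam_knot T i m : (i <= T)%N ->
  knot T.+1 i < m <= knot T.+1 i.+1 -> Gam U b T m = i.
Proof.
move=> iT imi; have /andP[im _] := imi.
have m0 : 0 < m by rewrite (le_lt_trans _ im)// knot_ge0// leqW// leqW.
by rewrite /Gam gt_eqF// (pick_knot _ _ i)// insubT.
Qed.

Lemma Gam0 T : Gam U b T 0 = 0%N. Proof. by rewrite /Gam eqxx. Qed.

Lemma Gam_bounds T m : 0 < m <= U ->
  (Gam U b T m <= T)%N /\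
  knot T.+1 (Gam U b T m) < m <= knot T.+1 (Gam U b T m).+1.
Proof.
move=> /andP[m0 mU]; have [|i iT mi] := knot_locate T.+1 T.+1 m isT m0.
  by rewrite knot_full.
by rewrite (Gam_knot T i).
Qed.

Lemma Gam_le T m : (Gam U b T m <= T)%N.
Proof.
rewrite /Gam; case: ifP => // _; case: pickP => //= i _.
exact: leq_ord.
Qed.

Lemma Gam_le_knot T m : 0 <= m <= U -> m <= knot T.+1 (Gam U b T m).+1.
Proof.
rewrite le_eqVlt => /andP[/predU1P[<- _|m0 mU]]; first by rewrite Gam0 knot_ge0.
by have [|_ /andP[]] := Gam_bounds T m; first by rewrite m0.
Qed.

Lemma coefB_knot T i : coefB U b T i%:Z = i%:R / (b + T%:R) * knot T i.+1.
Proof. by rewrite /coefB coefA_knot. Qed.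

Lemma coefB_last T : (0 < T)%N -> coefB U b T T%:Z = U.
Proof.
move=> T0; have T0' : T%:R != 0 :> rat by rewrite pnatr_eq0 -lt0n.
have bT := lt0r_neq0 (den_gt0 T).
by rewrite coefB_knot knot_last; field; rewrite T0' bT.
Qed.

Lemma coefB0 T : coefB U b T 0 = 0.
Proof. by rewrite (coefB_knot T 0) mul0r mul0r. Qed.

Lemma coefB_lt T i j : (i < j <= T)%N -> coefB U b T i%:Z < coefB U b T j%:Z.
Proof.
move=> /andP[ij jT].
have T0 : (0 < T)%N by rewrite (leq_trans _ jT)// (leq_ltn_trans _ ij).
rewrite !coefB_knot ltr_pM// ?knot_ge0//.
- by rewrite divr_ge0// ltW// den_gt0.
- by rewrite ltnS (leq_trans _ jT)// ltnW.
- by rewrite ltr_pM2r ?ltr_nat// invr_gt0 den_gt0.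
- by rewrite knot_lt// ltnS ij ltnS.
Qed.

Lemma coefB_le T i j : (i <= j <= T)%N -> coefB U b T i%:Z <= coefB U b T j%:Z.
Proof.
move=> /andP[]; rewrite leq_eqVlt => /predU1P[->//|ij jT].
by rewrite ltW// coefB_lt// ij.
Qed.

Lemma coefB_ge0 T i : (i <= T)%N -> 0 <= coefB U b T i%:Z.
Proof. by move=> iT; rewrite -(coefB0 T) (coefB_le T 0). Qed.

(** Ordering up to [chiMAR] triggers the law that has an atom at zero.  The
    breakpoints of horizon [T] dominate those of horizon [T.+1] used by [Gam],
    so the interval of [m] at horizon [T] has an index [i <= G]; the inventory
    [B^T_G] is therefore beyond [B^T_i], and it is the left end of the
    interval [k = G].  For [G = T] the inventory is [U], and for [m = 0] both
    sides are the point mass at zero. *)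
Lemma qlaw_chiMAR T (m : rat) : (0 < T)%N -> 0 <= m <= U ->
  let A := coefA U b T (minn (Gam U b T m) T.-1)%:Z in
  qlaw U b T (chiMAR U b T m) m =1 two_point 0 (1 - m / A) A (m / A).
Proof.
move=> T0 mU A y; have /andP[m0 mU'] := mU.
rewrite /qlaw; case: eqVneq => [->|mn0] /=.
  by rewrite /two_point !mul0r !mulr0.
have {m0} m0 : 0 < m by rewrite lt0r mn0.
set G := Gam U b T m in A *.
have [GT /andP[Gm mG]] : (G <= T)%N /\ knot T.+1 G < m <= knot T.+1 G.+1.
  by apply: Gam_bounds; rewrite m0.
rewrite /chiMAR -/G; case: (ltngtP G T) GT => // [GT _|GT _]; last first.
  rewrite /A GT coefB_last// eqxx (minn_idPr (leq_pred T)).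
  by rewrite coefA_knot prednK// knot_full.
have -> : A = knot T G.+1.
  by rewrite /A (minn_idPl _) ?coefA_knot// -ltnS prednK.
rewrite lt_eqF; last by rewrite -[ltRHS](coefB_last T)// coefB_lt// GT leqnn.
have mG' : m <= knot T G.+1.
  by rewrite (le_trans mG)// knot_horizon_le// ltnS ltnW.
have [i iG mi] := knot_locate G.+1 T m T0 m0 mG'.
have iT : (i < T)%N by apply: leq_trans GT.
rewrite (pick_knot T T i)// insubT /=.
rewrite [X in _ && X]ltNge coefB_le ?andbF; last by rewrite -ltnS iG ltnW.
have succZ k : (k%:Z + 1)%R = k.+1%:Z by rewrite intS addrC.
case: pickP => [k|/(_ (Ordinal GT))]; rewrite succZ; last first.
  by rewrite -ltnS iG lexx coefB_lt// ltnSn.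
move=> /and3P[_ kG Gk]; have -> : nat_of_ord k = G.
  apply/eqP; rewrite eqn_leq; apply/andP; split; rewrite leqNgt;
    apply/negP => h.
    by move: kG; rewrite leNgt coefB_lt// h ltnW.
  by move: Gk; rewrite ltNge coefB_le// h ltnW.
by rewrite coefA_knot.
Qed.

(** * The common path of the policy and the chain *)

Section Horizon.
Context (T : nat) (hT : (0 < T)%N) (mu : rat).

Local Notation G := (Gam U b T mu).
Local Notation L := (Lam U b T mu).

(** The state at time [t] of a demand that is still alive; from time [L] on the
    demand is [U], where it stays. *)
Definition levels (t : nat) : rat * rat :=
  if (t <= L)%N then (Xlev U b T mu t, Dlev U b T mu t) else (U, U).

(** The path when the demand survives [n] periods.  Surviving [L] periods means
    surviving forever, hence the truncation of [t] at [L].  A demand that dies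
    does so at time [n.+1], and the inventory is frozen at the level of that
    time. *)
Definition traj (n t : nat) : rat * rat :=
  if (minn t L <= n)%N then levels t else ((levels n.+1).1, 0).

Lemma Lam_bounds : (1 <= L <= T)%N.
Proof. by rewrite /Lam; have := Gam_le T mu; lia. Qed.

(** The truncations at the number [n] of remaining periods give one formula
    for the times before and after [L]: for [n < G] both components are [U]. *)
Lemma levelsE t n : (0 < t)%N -> T = (t + n)%N ->
  levels t = (coefB U b n.+1 (minn G n.+1)%:Z, coefA U b n.+1 (minn G n)%:Z).
Proof.
move=> t0 Tt; have GT := Gam_le T mu.
rewrite /levels /Lam; case: leqP => tL; last first.
  rewrite (minn_idPr _) ?coefB_last//; last by lia.
  by rewrite (minn_idPr _) ?coefA_knot ?knot_full//; lia.
rewrite /Xlev /Dlev.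
have -> : (T + 1 - t = n.+1)%N by lia.
have -> : minn G n.+1 = G by lia.
by have -> : minn G (T - 1) = minn G n by lia.
Qed.

Lemma levels_late t : (T < t)%N -> levels t = (U, U).
Proof.
move=> Tt; rewrite /levels leqNgt (leq_ltn_trans _ Tt)//.
by have /andP[] := Lam_bounds.
Qed.

Lemma levels1 : levels 1 = (chiMAR U b T mu, coefA U b T (minn G T.-1)%:Z).
Proof.
have GT := Gam_le T mu.
rewrite (levelsE 1 T.-1)//; last by rewrite add1n prednK.
by rewrite prednK// (minn_idPl GT).
Qed.

(** The levels follow the recursion of the policy.  At horizon [n.+1], the level
    [A^(n+2)_(min(G, n+1))] is the right end of the interval of index
    [min(G, n+1)], which is therefore its own [Gam]. *)
Lemma levels_succ t : (0 < t < T)%N ->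
  let m := (levels t).2 in
  levels t.+1 = (chiMAR U b (T - t) m,
                 coefA U b (T - t) (minn (Gam U b (T - t) m) (T - t).-1)%:Z).
Proof.
move=> /andP[t0 tT] m; have [n Tn] : exists n, T = (t.+1 + n)%N.
  by exists (T - t.+1)%N; lia.
have -> : (T - t = n.+1)%N by lia.
have Gm : Gam U b n.+1 m = minn G n.+1.
  rewrite /m (levelsE t n.+1)//=; last by lia.
  rewrite coefA_knot; apply: Gam_knot; rewrite ?geq_minr// lexx andbT.
  by rewrite knot_lt//; lia.
rewrite /chiMAR Gm (levelsE t.+1 n)//=.
by have -> : minn (minn G n.+1) n = minn G n by lia.
Qed.

Lemma levels_bounds t : (0 < t)%N ->
  [/\ 0 <= (levels t).1, (levels t).1 <= (levels t).2, 0 < (levels t).2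
    & (levels t).2 <= U].
Proof.
move=> t0; have [Tt|tT] := ltnP T t; first by rewrite levels_late//= ltW.
have {tT} [n Tn] : exists n, T = (t + n)%N by exists (T - t)%N; lia.
rewrite (levelsE t n)//= coefA_knot; split.
- by rewrite coefB_ge0// geq_minr.
- have [Gn|nG] := leqP G n.
    rewrite (minn_idPl _) ?coefB_knot ?leqW// ler_piMl ?knot_ge0//; first lia.
    by rewrite ler_pdivrMr ?den_gt0// mul1r ler_wpDl ?ler_nat ?leqW// ltW.
  by rewrite (minn_idPr _)// coefB_last// knot_full.
- by rewrite knot_gt0//; lia.
- by rewrite -[leRHS](knot_full n.+1) knot_le//; lia.
Qed.

(** As the number of remaining periods decreases, the index [G] stays and
    [knot_horizon_le] makes [A] grow; for [B] the factor [G / (b + n)] grows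
    too.  Where an index is truncated the component has reached [U]. *)
Lemma levels_mono_succ t : (0 < t)%N ->
  (levels t).1 <= (levels t.+1).1 /\ (levels t).2 <= (levels t.+1).2.
Proof.
move=> t0; have [Tt|tT] := ltnP T t.+1.
  rewrite [levels t.+1]levels_late//=; have [_ XD _ DU] := levels_bounds t t0.
  by split=> //; apply: le_trans DU.
have {tT} [n Tn] : exists n, T = (t.+1 + n)%N by exists (T - t.+1)%N; lia.
rewrite (levelsE t n.+1) ?(levelsE t.+1 n)//=; last by lia.
rewrite !coefA_knot; split.
  have [Gn|nG] := leqP G n.+1; last by rewrite (minn_idPr nG) !coefB_last.
  rewrite (minn_idPl (leqW Gn)) !coefB_knot ler_pM// ?knot_ge0//.
  - by rewrite divr_ge0// ltW// den_gt0.
  - lia.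
  - by rewrite ler_wpM2l// lef_pV2 ?posrE ?den_gt0// lerD2l ler_nat.
  - exact: knot_horizon_le.
have [Gn|nG] := leqP G n.
  by rewrite (minn_idPl (leqW Gn)) knot_horizon_le//; lia.
by rewrite (minn_idPr nG) !knot_full.
Qed.

Lemma levels_mono s t : (0 < s <= t)%N ->
  (levels s).1 <= (levels t).1 /\ (levels s).2 <= (levels t).2.
Proof.
move=> /andP[s0]; elim: t => [|t IH]; first by rewrite leqNgt s0.
rewrite leq_eqVlt => /predU1P[->//|]; rewrite ltnS => st.
have [x y] := IH st; have [x' y'] := levels_mono_succ t (leq_trans s0 st).
by split; [apply: le_trans x'|apply: le_trans y'].
Qed.

Lemma levels_Lam : (levels L).2 = U.
Proof.
have /andP[L1 LT] := Lam_bounds; have GT := Gam_le T mu.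
rewrite (levelsE L (T - L))//=; last by lia.
have -> : minn G (T - L) = (T - L)%N by move: LT; rewrite /Lam; lia.
by rewrite coefA_knot knot_full.
Qed.

Lemma levels_minn t : (levels (minn t L)).2 = (levels t).2.
Proof.
have [//|Lt] := leqP t L.
by rewrite levels_Lam /levels leqNgt Lt.
Qed.

Lemma traj_alive n t : (minn t L <= n)%N -> traj n t = levels t.
Proof. by rewrite /traj => ->. Qed.

Lemma traj_dead n t : (n < minn t L)%N -> traj n t = ((levels n.+1).1, 0).
Proof. by move=> dead; rewrite /traj leqNgt dead. Qed.

Lemma traj_eq0 n t : (0 < t)%N -> ((traj n t).2 == 0) = (n < minn t L)%N.
Proof.
move=> t0; have [_ _ D0 _] := levels_bounds t t0.
by case: leqP => h; [rewrite traj_alive// gt_eqF | rewrite traj_dead//= eqxx].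
Qed.

Lemma traj_absorbing n t s : (t <= s)%N -> (n < minn t L)%N ->
  traj n s = traj n t.
Proof. by move=> ts h; rewrite !traj_dead//; lia. Qed.

(** While the demand is alive the previous inventory is covered by the demand,
    so the maximum is the new order-up-to level; once it is dead, the
    order-up-to level is zero and the inventory is kept.  The list [d] only
    has to agree with the path before time [t], which lets the induction use
    the same [d] throughout. *)
Lemma xhat_traj x0 n t d : 0 <= x0 <= chiMAR U b T mu -> (0 < t <= T)%N ->
  (forall s, (0 < s < t)%N -> d`_s.-1 = (traj n s).2) ->
  xhat U b T mu x0 t d = (traj n t).1.
Proof.
move=> /andP[x00 x0chi]; elim: t => // -[_ _ _|t IH tT dM].
  have L1 : minn 1 L = 1%N by have := Lam_bounds; lia.
  have -> : xhat U b T mu x0 1 d = Num.max x0 (chiMAR U b T mu) by [].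
  rewrite (max_idPr x0chi).
  have -> : chiMAR U b T mu = (levels 1).1 by rewrite levels1.
  by case: n => [|n]; [rewrite traj_dead ?L1|rewrite traj_alive ?L1].
have tT' : (0 < t.+1 < T)%N by lia.
have -> : xhat U b T mu x0 t.+2 d =
    Num.max (xhat U b T mu x0 t.+1 d - d`_t) (chiMAR U b (T - t.+1) d`_t) by [].
rewrite IH ?(dM t.+1) ?ltnSn//; first last.
- by move=> s sT; apply: dM; lia.
- lia.
have [alive|dead] := leqP (minn t.+1 L) n; last first.
  rewrite (traj_absorbing n t.+1 t.+2)// traj_dead//= subr0 /chiMAR Gam0 coefB0.
  by rewrite (max_idPl _)//; have [] := levels_bounds n.+1 isT.
rewrite traj_alive//; have [_ XD _ _] := levels_bounds t.+1 isT.
have [+ _ _ _] := levels_bounds t.+2 isT; rewrite (levels_succ t.+1)//= => chi0.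
rewrite (max_idPr _); last by rewrite (le_trans _ chi0)// subr_le0.
(* Also a demand that dies right now finds the inventory at the new level. *)
rewrite /traj; case: leqP => [_|dead]; first by rewrite (levels_succ t.+1).
have -> : n = t.+1 by lia.
by rewrite (levels_succ t.+1).
Qed.

(** * The path is the Markov chain *)

Definition alive (t : nat) : set nat := [set n | (minn t L <= n)%N].

Lemma aliveP t n : (0 < t)%N -> alive t n <-> (traj n t).2 != 0.
Proof.
by move=> t0; rewrite traj_eq0// -leqNgt.
Qed.

Lemma not_aliveP t n : ~ alive t n <-> (n < minn t L)%N.
Proof. by rewrite /alive/= ltnNge; split=> /negP. Qed.

Lemma alive_prefix n t s : (s <= t)%N -> alive t n -> alive s n.
Proof. by rewrite /alive/=; lia. Qed.

Context (R : realType) (hmu : 0 <= mu <= U).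

Lemma le_levels1 : mu <= (levels 1).2.
Proof.
have GT := Gam_le T mu; rewrite levels1/= coefA_knot.
have [GT'|TG] := ltnP G T; last first.
  rewrite (minn_idPr _) ?prednK ?knot_full//; last by lia.
  by case/andP: hmu.
rewrite (minn_idPl _); last by lia.
by rewrite (le_trans (Gam_le_knot T mu hmu))// knot_horizon_le// leqW.
Qed.

(** [mu / levels t] is a survival function because [mu] is below the first
    level and the levels increase; it is constant from time [L] on. *)
Lemma exists_death_law : exists P : probability nat R,
  forall t, (0 < t)%N -> P (alive t) = (ratr (mu / (levels t).2))%:E.
Proof.
have [mu0 muU] := andP hmu.
pose S t : R := if t is s.+1 then ratr (mu / (levels t).2) else 1.
have D0 t : (0 < t)%N -> 0 < (levels t).2.
  by move=> /levels_bounds[].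
have S_noninc n : (n < L)%N -> S n.+1 <= S n.
  move=> _; case: n => [|n]; rewrite /S.
    rewrite -(rmorph1 (ratr : rat -> R)) ler_rat ler_pdivrMr ?D0// mul1r.
    exact: le_levels1.
  rewrite ler_rat ler_wpM2l// lef_pV2 ?posrE ?D0//.
  by have [] := levels_mono_succ n.+1 isT.
have S_ge0 n : 0 <= S n.
  by case: n => [|n]; rewrite /S// ler0q divr_ge0// ltW ?D0.
have [P PS] := survival_law R S L erefl S_noninc (S_ge0 L).
exists P => t t0; rewrite PS ?geq_minr// -levels_minn//.
have : (0 < minn t L)%N by have := Lam_bounds; lia.
by case: (minn t L).
Qed.

Context (P : probability nat R).
Context (alive_law : forall t, (0 < t)%N ->
  P (alive t) = (ratr (mu / (levels t).2))%:E).

Lemma alive_step t : (0 < t)%N -> (0 < P (alive t))%E ->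
  cprob P (alive t.+1) (alive t) = ratr ((levels t).2 / (levels t.+1).2).
Proof.
move=> t0 Pt; rewrite /cprob setIidl; last by move=> n; apply: alive_prefix.
move: Pt; rewrite !alive_law// lte_fin ltr0q/= -fmorphV -rmorphM => Pt.
have mu0 : mu != 0 by apply: contraTneq Pt => ->; rewrite mul0r ltxx.
congr ratr.
have [_ _ D0 _] := levels_bounds t t0.
have [_ _ D1 _] := levels_bounds t.+1 isT.
by field; rewrite mu0 !gt_eqF.
Qed.

Lemma step_law t (y : rat) : (0 < t)%N -> (0 < P (alive t))%E ->
  cprob P [set n | (traj n t.+1).2 = y] (alive t)
  = ratr (two_point 0 (1 - (levels t).2 / (levels t.+1).2) (levels t.+1).2
            ((levels t).2 / (levels t.+1).2) y).
Proof.
move=> t0 F0; have [_ _ D1 _] := levels_bounds t.+1 isT.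
apply: (@cprob_two_point _ _ _ _ _ (alive t.+1)) => //; first by rewrite gt_eqF.
- by move=> n _ /traj_alive ->.
- by move=> n _ /not_aliveP h; rewrite traj_dead.
- exact: alive_step.
Qed.

(** If the present state is alive, then the past and the present are the same
    event, since being alive determines the path so far.  If it is dead, the
    past may carry more information (the time of death), but the next state is
    the present one with certainty. *)
Lemma traj_markov : markov_property P (fun t n => traj n t).
Proof.
move=> t s y t0 past past0; have [w0 w0past] := prob_gt0_nonempty past0.
have tt : (0 < t <= t)%N by rewrite t0 leqnn.
have now n : past n -> traj n t = s t by apply.
have [al|dead] := pselect (alive t w0).
  have s0 : (s t).2 != 0 by rewrite -(now w0)//; apply/aliveP.
  have nowE : [set n | traj n t = s t] = alive t.
    apply/seteqP; split=> n /=; first by move=> nt; apply/aliveP; rewrite ?nt.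
    by move=> an; rewrite -(now w0)// !traj_alive.
  have -> : past = alive t.
    rewrite -nowE; apply/seteqP; split=> n; first exact: now.
    rewrite nowE => an r /andP[r0 rt]; rewrite -w0past ?r0// !traj_alive//.
      exact: alive_prefix al.
    exact: alive_prefix an.
  by rewrite nowE.
have s0 : (s t).2 = 0 by rewrite -(now w0)// traj_dead//; apply/not_aliveP.
have stay n : traj n t = s t -> traj n t.+1 = s t.
  move=> nt; rewrite (traj_absorbing n t t.+1)//.
  by rewrite -traj_eq0// nt s0.
have now0 : (0 < P [set n | traj n t = s t])%E.
  by apply: lt_le_trans past0 _; apply: le_measure; rewrite ?inE.
by rewrite !(cprob_const (s t))// => n /now/stay.
Qed.

Lemma traj_chain_MT : is_chain_MT P U b T mu (fun t n => traj n t).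
Proof.
have /andP[L0 _] := Lam_bounds.
have [_ _ D1 _] := levels_bounds 1 isT.
have lev1 : levels 1 = (Xlev U b T mu 1, Dlev U b T mu 1) by rewrite /levels L0.
have L1 : minn 1 L = 1%N by lia.
split => //.
- exact: traj_markov.
- have a1 : [set n | traj n 1 = (Xlev U b T mu 1, Dlev U b T mu 1)] = alive 1.
    apply/seteqP; split=> n /=; last by move=> /traj_alive ->.
    by rewrite -lev1 => n1; apply/aliveP => //; rewrite n1 gt_eqF.
  have n1 : [set n | traj n 1 = (Xlev U b T mu 1, 0)] = ~` alive 1.
    apply/seteqP; split=> n /=.
      by move=> n1 /aliveP; rewrite n1 eqxx => /(_ isT).
    move=> /not_aliveP n1; rewrite traj_dead//.
    by move: n1; rewrite L1 => /[1!ltnS]; rewrite leqn0 => /eqP->; rewrite lev1.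
  rewrite a1 n1 probability_setC// alive_law// lev1/=; split => //.
  by rewrite rmorphB rmorph1 EFinB.
- move=> t x y /andP[t2 tL] past past0.
  have [w0 w0past] := prob_gt0_nonempty past0.
  have t1 : (0 < t.-1)%N by lia.
  have tS : t = t.-1.+1 by lia.
  split=> [y0|/eqP y0].
    rewrite (cprob_const (x, 0)) ?eqxx// => n /= nt.
    rewrite (traj_absorbing n t.-1 t) ?nt ?y0//; first by lia.
    by rewrite -traj_eq0// nt y0.
  have pastE : past = alive t.-1.
    apply/seteqP; split=> n; first by move=> nt; apply/aliveP => //; rewrite nt.
    move=> an; rewrite /past /= -w0past !traj_alive//.
    by apply/aliveP => //; rewrite w0past.
  have alive0 : (0 < P (alive t.-1))%E by rewrite -pastE.
  have levt : levels t = (Xlev U b T mu t, Dlev U b T mu t).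
    by rewrite /levels tL.
  have levp : levels t.-1 = (Xlev U b T mu t.-1, Dlev U b T mu t.-1).
    by rewrite /levels (leq_trans (leq_pred _) tL).
  have [_ _ Dt _] := levels_bounds t (ltnW t2).
  have survE : cprob P (alive t) past
      = ratr (Dlev U b T mu t.-1 / Dlev U b T mu t).
    by rewrite pastE {1}tS alive_step// -tS levt levp.
  split.
    rewrite -survE; apply: cprob_ext => n _.
    split=> [/= nt|/traj_alive /= ->//].
    by apply/aliveP; [exact: ltnW|rewrite nt gt_eqF//; rewrite levt in Dt].
  have -> : ratr (1 - Dlev U b T mu t.-1 / Dlev U b T mu t)
      = 1 - cprob P (alive t) past.
    by rewrite survE rmorphB rmorph1.
  rewrite -cprobC//; apply: cprob_ext => n; rewrite pastE => an.
  split=> [/= nt /aliveP|/not_aliveP dn].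
    by rewrite nt eqxx => /(_ (ltnW t2)).
  (* Alive at t - 1 and dead at t: the death occurs exactly at t. *)
  rewrite /= traj_dead//; have -> : n.+1 = t by move: an; rewrite /alive/=; lia.
  by rewrite levt.
- move=> t n Lt; have [aL|/not_aliveP dL] := pselect (alive L n).
    rewrite traj_alive// levels_Lam; split=> [U0|_].
      by move: hU; rewrite U0 ltxx.
    rewrite /traj ifT; first by rewrite /levels ifF//; lia.
    by move: aL; rewrite /alive/=; lia.
  rewrite (traj_absorbing n L t)//; last by lia.
  rewrite traj_dead//=; split => // U0; by move: hU; rewrite -U0 ltxx.
Qed.

(** * The demands of the path follow the worst-case measure *)

Definition demand (n : nat) : T.-tuple rat := [tuple (traj n t.+1).2 | t < T].

Lemma nth_demand n t : (t < T)%N -> (demand n)`_t = (traj n t.+1).2.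
Proof. by move=> tT; rewrite (nth_mktuple _ _ (Ordinal tT)). Qed.

Lemma nth_take_demand n t r : (0 < r <= t)%N -> (t <= T)%N ->
  (take t (demand n))`_r.-1 = (traj n r).2.
Proof.
move=> /andP[r0 rt] tT; have rr : r.-1.+1 = r by rewrite prednK.
by rewrite nth_take ?rr// nth_demand ?rr// (leq_trans rt).
Qed.

Lemma demand_prefix n n' t : (t <= T)%N ->
  (forall r, (0 < r <= t)%N -> (traj n r).2 = (traj n' r).2) ->
  take t (demand n) = take t (demand n').
Proof.
move=> tT nn'; have szt m : size (take t (demand m)) = t.
  by rewrite size_takel// size_tuple.
apply: (@eq_from_nth _ 0); rewrite !szt// => r rt.
by rewrite -[r]/(r.+1.-1) !nth_take_demand//; apply: nn'.
Qed.

(** Conditioning on the first [t] demands amounts either to conditioning on being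
    alive at time [t], where [xhat_traj] gives the inventory that nature sees
    and [qlaw_chiMAR] its answer, or to conditioning on an event where the
    demand is dead, where the law with mean zero is the point mass at zero. *)
Lemma demand_Qhat x0 : 0 <= x0 <= chiMAR U b T mu ->
  distributed_Qhat P U b mu x0 demand.
Proof.
move=> hx0; split => //.
- move=> n i; rewrite tnth_mktuple; case: (leqP (minn i.+1 L) n) => [al|dn].
    by rewrite traj_alive//; have [_ _ /ltW -> ->] := levels_bounds i.+1 isT.
  by rewrite traj_dead//= ltW.
- move=> y; have -> : xhat U b T mu x0 1 [::] = chiMAR U b T mu.
    by rewrite /=; apply/max_idPr; case/andP: hx0.
  rewrite qlaw_chiMAR//.
  rewrite -(_ : (levels 1).2 = coefA U b T (minn G T.-1)%:Z);
    last by rewrite levels1.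
  have [_ _ D0 _] := levels_bounds 1 isT.
  rewrite -(@cprob_two_point _ _ _ P setT (alive 1) (fun n => (demand n)`_0))//.
  + by rewrite cprob_setT fineK// fin_num_measure.
  + by rewrite probability_setT.
  + by rewrite gt_eqF.
  + by move=> n _ /traj_alive; rewrite nth_demand// => ->.
  + by move=> n _ /not_aliveP n1; rewrite nth_demand// traj_dead.
  + by rewrite cprob_setT alive_law.
move=> t s y /andP[t0 tT] F0; set F := [set n | _] in F0 *.
have [w0 Fw0] := prob_gt0_nonempty F0.
have sE n r : F n -> (0 < r <= t)%N -> s`_r.-1 = (traj n r).2.
  by move=> <- rt; rewrite nth_take_demand// ltnW.
have tt : (0 < t <= t)%N by rewrite t0 leqnn.
have -> : cprob P [set n | (demand n)`_t = y] F =
          cprob P [set n | (traj n t.+1).2 = y] F.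
  by apply: cprob_ext => n _; rewrite /= nth_demand.
have [al|dead] := pselect (alive t w0).
  have FE : F = alive t.
    apply/seteqP; split=> n.
      move=> Fn; apply/aliveP => //.
      by rewrite -(sE n)// (sE w0)//; apply/aliveP.
    move=> an; rewrite /F /= -Fw0; apply: demand_prefix; first exact: ltnW.
    move=> r /andP[_ rt]; rewrite !traj_alive//; first exact: alive_prefix al.
    exact: alive_prefix an.
  (* The level xhat needs is read off the path that never dies: the one of w0
     may die at time t + 1. *)
  have trajL r : traj L r = levels r by rewrite traj_alive ?geq_minr.
  rewrite (@xhat_traj x0 L)//; last first.
    move=> r rt; have rt' : (0 < r <= t)%N by lia.
    rewrite trajL (sE w0)// traj_alive//.
    by apply: alive_prefix al; case/andP: rt'.
  rewrite trajL (sE w0)// traj_alive// FE step_law -?FE//.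
  have tT' : (0 < t < T)%N by rewrite t0.
  rewrite [in RHS](levels_succ t)//= qlaw_chiMAR ?subn_gt0//; last first.
    by have [_ _ /ltW -> ->] := levels_bounds t t0.
  by rewrite [in LHS](levels_succ t).
rewrite (sE w0)// traj_dead; last exact/not_aliveP.
rewrite /qlaw eqxx/= /two_point mul0r subr0 mulr0 addr0 mulr1.
have zero n : F n -> (traj n t.+1).2 = 0.
  move=> Fn; have : (traj n t).2 == 0.
    by rewrite -(sE n)// (sE w0)// traj_eq0//; apply/not_aliveP.
  by rewrite traj_eq0// => dn; rewrite (traj_absorbing n t t.+1)// traj_dead.
by rewrite (cprob_const 0)// rmorph_nat.
Qed.

End Horizon.
End Model.

Theorem corollary1 (R : realType) (U b : rat) (T : nat) (mu x0 : rat)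
  (hU : 0 < U) (hb : 0 < b) (hT : (1 <= T)%N)
  (hmu : 0 <= mu <= U) (hx0 : 0 <= x0 <= U)
  (hx0chi : 0 <= x0 <= chiMAR U b T mu) :
  (exists (d : measure_display) (Om : measurableType d) (P : probability Om R)
          (Dhat : Om -> T.-tuple rat) (M : nat -> Om -> rat * rat),
    [/\ distributed_Qhat P U b mu x0 Dhat,
        is_chain_MT P U b T mu M
      & P [set w | forall t : nat, (1 <= t <= T)%N ->
             (xhat U b T mu x0 t (take t.-1 (Dhat w)), (Dhat w)`_t.-1)
             = M t w] = 1%E])
  /\ [/\ (forall s t : nat, (1 <= s)%N -> (s <= t)%N ->
            (t <= Lam U b T mu)%N -> Dlev U b T mu s <= Dlev U b T mu t),
         (forall s t : nat, (1 <= s)%N -> (s <= t)%N ->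
            (t <= Lam U b T mu)%N -> Xlev U b T mu s <= Xlev U b T mu t),
         (forall t : nat, (1 <= t <= Lam U b T mu)%N ->
            Xlev U b T mu t <= Dlev U b T mu t)
       & Dlev U b T mu (Lam U b T mu) = U].
Proof.
have levE t : (t <= Lam U b T mu)%N ->
    levels U b T mu t = (Xlev U b T mu t, Dlev U b T mu t).
  by rewrite /levels => ->.
have mono s t : (0 < s)%N -> (s <= t)%N -> (t <= Lam U b T mu)%N ->
    Xlev U b T mu s <= Xlev U b T mu t /\ Dlev U b T mu s <= Dlev U b T mu t.
  move=> s0 st tL; have := @levels_mono U b hU hb T hT mu s t.
  by rewrite (levE s (leq_trans st tL)) levE// s0 st => /(_ isT).
split; last first.
  split.
  - by move=> s t s0 st /(mono s t s0 st)[].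
  - by move=> s t s0 st /(mono s t s0 st)[].
  - move=> t /andP[t0 tL]; have := @levels_bounds U b hU hb T hT mu t t0.
    by rewrite levE// => -[].
  - by have := @levels_Lam U b hU hb T hT mu; rewrite levE.
have [P alive_law] := @exists_death_law U b hU hb T hT mu R hmu.
exists _, nat, P, (demand U b T mu), (fun t n => traj U b T mu n t); split.
- exact: demand_Qhat.
- exact: traj_chain_MT.
rewrite -(@probability_setT _ _ _ P); congr (P _).
apply/seteqP; split => // n _ t /andP[t0 tT].
rewrite (@xhat_traj U b hU hb T hT mu x0 n t)// ?t0//; last first.
  by move=> s st; apply: nth_take_demand; lia.
by rewrite nth_demand ?prednK//; case: (traj _ _ _ _ _ _).
Qed.
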